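(* Let $Z\sim P$ and let $\{X_f\}_{f\in\mathcal F}$ be a family of random variables of the form $X_f=g_f(Z)$. Let $\eta>0$. Let $\Pi_0$ be a probability distribution on $\mathcal F$ and let $\hat\Pi$ be a probability distribution on $\mathcal F$, possibly depending on the data $Z$, such that $\hat\Pi$ and $\Pi_0$ are equivalent (have the same null sets). Then: 1. $$\mathbf E_{\bar f\sim\hat\Pi}[X_{\bar f}]-\mathbf A^\eta_{(Z,\bar f)\sim P\otimes\Pi_0}[X_{\bar f}]\trianglelefteq_\eta\frac{\mathrm{KL}(\hat\Pi\|\Pi_0)}{\eta}.$$ 2. If moreover $X_f\trianglelefteq_\eta0$ for each $f\in\mathcal F$, then $$\mathbf E_{\bar f\sim\hat\Pi}[X_{\bar f}]\trianglelefteq_\eta\frac{\mathrm{KL}(\hat\Pi\|\Pi_0)}{\eta}.$$ 3. For arbitrary $\{X_f\}_{f\in\mathcal F}$ (without the assumption of part 2), $$\mathbf E_{\bar f\sim\hat\Pi}\big[X_{\bar f}-\mathbf A^\eta_{Z\sim P}[X_{\bar f}]\big]\trianglelefteq_\eta\frac{\mathrm{KL}(\hat\Pi\|\Pi_0)}{\eta}.$$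
   Context: For $\eta>0$ and random variables $X,Y$ (functions of $Z\sim P$), $X\trianglelefteq_\eta Y$ means $\mathbf E_{Z\sim P}[e^{\eta(X-Y)}]\le1$. The annealed expectation is $\mathbf A^\eta_{Q}[W]=\frac1\eta\log\mathbf E_Q[e^{\eta W}]$, the subscript giving the distribution of the underlying variables: $\mathbf A^\eta_{(Z,\bar f)\sim P\otimes\Pi_0}[X_{\bar f}]=\frac1\eta\log\mathbf E_{Z\sim P}\mathbf E_{\bar f\sim\Pi_0}[e^{\eta g_{\bar f}(Z)}]$ is a constant, and for fixed $f$, $\mathbf A^\eta_{Z\sim P}[X_f]=\frac1\eta\log\mathbf E_{Z\sim P}[e^{\eta g_f(Z)}]$. $\mathbf E_{\bar f\sim\hat\Pi}[\cdot]$ averages over $\bar f\sim\hat\Pi$ only, so the result is still a function of $Z$. $\mathrm{KL}(\hat\Pi\|\Pi_0)=\mathbf E_{\hat\Pi}[\log\frac{d\hat\Pi}{d\Pi_0}]$, which may also be a function of $Z$. It is implicit throughout that $(f,z)\mapsto g_f(z)$ and $z\mapsto\hat\Pi$ are suitably measurable and that the expectations appearing are well defined. *)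

(* Defs.v *)
From HB Require Import structures.
From mathcomp Require Import all_boot all_order all_algebra.
From mathcomp Require Import all_classical all_reals all_analysis.

Set Implicit Arguments.
Unset Strict Implicit.
Unset Printing Implicit Defensive.

Import Order.TTheory GRing.Theory Num.Theory.

Local Open Scope classical_set_scope.
Local Open Scope ring_scope.
Local Open Scope ereal_scope.
Local Open Scope charge_scope.

(* Random variables are functions on the space carrying the law P of Z.
   Infinite values are legitimate (a divergence, an exponential moment or an
   expectation may be infinite), so all quantities live in \bar R, with
   expeR -oo = 0, expeR +oo = +oo, lne 0 = -oo, lne +oo = +oo.  Both a
   difference +oo - +oo and the integral of a function whose positive and
   negative parts both have infinite integral are equal to -oo. *)

(* Exponential stochastic inequality: E_P [exp (eta (X - Y))] <= 1. *)
Definition esi (d : measure_display) (T : measurableType d) (R : realType)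
    (eta : R) (P : probability T R) (X Y : T -> \bar R) : Prop :=
  \int[P]_z expeR (eta%:E * (X z - Y z)) <= 1.

(* Annealed expectation; it is +oo when the exponential moment is infinite. *)
Definition annealed (d : measure_display) (T : measurableType d) (R : realType)
    (eta : R) (Q : probability T R) (W : T -> R) : \bar R :=
  (eta^-1)%:E * lne (\int[Q]_w (expR (eta * W w))%:E).

(* The Radon-Nikodym derivative is meaningful only if Q `<< Q0 (it is a junk
   value otherwise); this is the only case in which KL is used.  The negative
   part of the integrand is then always Q-integrable. *)
Definition KL (d : measure_display) (T : measurableType d) (R : realType)
    (Q Q0 : probability T R) : \bar R :=
  \int[Q]_f lne (('d (charge_of_finite_measure Q) '/d Q0) f).

Definition same_null_sets (d : measure_display) (T : measurableType d)
    (R : realType) (Q Q0 : probability T R) : Prop :=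
  Q `<< Q0 /\ Q0 `<< Q.

(* Main.v *)
Require Import Defs.
From HB Require Import structures.
From mathcomp Require Import all_boot all_order all_algebra.
From mathcomp Require Import all_classical all_reals all_analysis.
From mathcomp Require Import measurable_realfun.
From mathcomp Require Import ring lra.

Set Implicit Arguments.
Unset Strict Implicit.
Unset Printing Implicit Defensive.

Import Order.TTheory GRing.Theory Num.Theory.

Local Open Scope classical_set_scope.
Local Open Scope ring_scope.
Local Open Scope ereal_scope.

(* By Jensen's inequality under the posterior Q, applied to h minus the
   log-density l of Q with respect to the prior Q0,
     exp (E_Q h - KL(Q || Q0)) <= E_Q [exp (h - l)] <= E_Q0 [exp h]
   (the Donsker-Varadhan inequality). Taking h = eta X_f pointwise in Z,
   integrating over P and exchanging E_P with E_Q0 bounds the left-hand side of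
   each exponential inequality by the prior average of an exponential moment of
   X_f under P. Subtracting an annealed expectation normalizes this moment; it
   suffices that the normalized moment is at most 1, since the annealed
   expectation may be +oo, and then the moment is 0. *)

(* Unlike [ge0_le_integral], this requires no measurability: the integral of a
   nonnegative function is a supremum over simple functions below it. *)
Lemma le_integral_lower (d : measure_display) (T : measurableType d)
    (R : realType) (mu : {measure set T -> \bar R}) (f g : T -> \bar R) :
  (forall x, 0 <= f x) -> (forall x, f x <= g x) ->
  \int[mu]_x f x <= \int[mu]_x g x.
Proof.
move=> f0 fg; have g0 x : 0 <= g x by exact: le_trans (fg x).
rewrite !ge0_integralTE//; apply: le_ereal_sup => _ [h hf <-].
by exists h => // x; exact: le_trans (hf x) (fg x).
Qed.

Lemma measurable_fun_expeR (d : measure_display) (T : measurableType d)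
    (R : realType) (h : T -> \bar R) :
  measurable_fun [set: T] h -> measurable_fun [set: T] (fun x => expeR (h x)).
Proof.
move=> mh.
have -> : (fun x => expeR (h x)) =
    (fun x => if h x == -oo then 0
              else if h x == +oo then +oo else (expR (fine (h x)))%:E).
  by apply/funext => x; case: (h x).
apply: measurable_fun_ifT => //; first exact: measurable_fun_eqe.
apply: measurable_fun_ifT => //; first exact: measurable_fun_eqe.
apply/measurable_EFinP; apply: measurableT_comp => //.
exact: measurableT_comp.
Qed.

Lemma measurable_fun_lne (d : measure_display) (T : measurableType d)
    (R : realType) (h : T -> \bar R) :
  measurable_fun [set: T] h -> measurable_fun [set: T] (fun x => lne (h x)).
Proof.
move=> mh.
have -> : (fun x => lne (h x)) =
    (fun x => if h x <= 0 then -oo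
              else if h x == +oo then +oo else (ln (fine (h x)))%:E).
  by apply/funext => x; case: (h x) => [r| |]; rewrite ?lee_fin ?leNye.
apply: measurable_fun_ifT => //; first exact: measurable_fun_lee.
apply: measurable_fun_ifT => //; first exact: measurable_fun_eqe.
apply/measurable_EFinP; apply: measurableT_comp => //.
exact: measurableT_comp.
Qed.

Lemma integrable_funepos_funeneg (d : measure_display) (T : measurableType d)
    (R : realType) (mu : {measure set T -> \bar R}) (f : T -> \bar R) :
  measurable_fun [set: T] f ->
  \int[mu]_x f^\+ x < +oo -> \int[mu]_x f^\- x < +oo ->
  mu.-integrable [set: T] f.
Proof.
move=> mf fp fn; apply/integrableP; split => //.
under eq_integral do rewrite -/((abse \o f) _) fune_abse.
rewrite ge0_integralD//; [exact: lte_add_pinfty| |].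
  exact: measurable_funepos.
exact: measurable_funeneg.
Qed.

(* [l] is the logarithm of the density of [Q] where this density is positive,
   which is Q-almost everywhere, and [0] elsewhere. Being real-valued, it
   replaces division by the density with multiplication by [expR (- l)]. *)
Lemma log_density (d : measure_display) (T : measurableType d)
    (R : realType) (Q Q0 : probability T R) :
  Q `<< Q0 -> exists l : T -> R,
  [/\ measurable_fun [set: T] l, KL Q Q0 = \int[Q]_x (l x)%:E &
      forall f : T -> \bar R, measurable_fun [set: T] f ->
        (forall x, 0 <= f x) ->
        \int[Q]_x (f x * (expR (- l x))%:E) <= \int[Q0]_x f x].
Proof.
move=> QQ0; pose r := Radon_Nikodym_SigmaFinite.f Q Q0.
have r0 x : 0 <= r x by exact: Radon_Nikodym_SigmaFinite.f_ge0.
have rfin x : r x \is a fin_num by exact: Radon_Nikodym_SigmaFinite.f_fin_num.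
have mr : measurable_fun [set: T] r.
  exact/(measurable_int Q0)/Radon_Nikodym_SigmaFinite.f_integrable.
have mfr : measurable_fun [set: T] (fine \o r) by exact: measurableT_comp.
pose l x := ln (fine (r x)).
have ml : measurable_fun [set: T] l by exact: measurableT_comp.
exists l; split => //.
(* The zero set of the density [r] is null for [Q], as its measure is the integral of [r] over it.
   The values of [l] there are therefore irrelevant to [KL]. *)
- have mN : measurable [set x | r x = 0].
    by have := mr measurableT _ (emeasurable_set1 0); rewrite setTI.
  have QN : Q [set x | r x = 0] = 0.
    rewrite (Radon_Nikodym_SigmaFinite.f_integral QQ0)//.
    by rewrite integral0_eq.
  apply: ae_eq_integral => //.
  + by apply: measurable_fun_lne.
  + exact/measurable_EFinP.
  (* The derivative inside [KL] equals [r] almost everywhere for [Q0], hence for [Q] by domination;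
     [lne (r x)] equals [l x] wherever [r x] is positive. *)
  apply: (ae_eq_trans (g := fun x => lne (r x))).
    apply: ae_eq_sym; apply: (null_dominates_ae_eq measurableT QQ0).
    have := ae_eq_Radon_Nikodym_SigmaFinite QQ0 measurableT.
    by apply: filterS => x /= E _; rewrite /r E.
  exists [set x | r x = 0]; split => // x /= /not_implyP [_].
  apply: contra_notP => /eqP rx0; rewrite /l -[r x]fineK//= leNgt.
  by rewrite -lte_fin fineK// lt0e rx0 r0.
- move=> f mf f0.
  rewrite -(Radon_Nikodym_SigmaFinite.change_of_variables QQ0)//=.
  + apply: le_integral_lower => x.
      by rewrite !mule_ge0// lee_fin expR_ge0.
    (* [expR (- l x) * r x] is 1 where the density is positive and 0 where it vanishes, so mass of
       [Q0] may be lost there. *)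
    rewrite -muleA -[leRHS]mule1 lee_wpmul2l// -/r -[r x]fineK// -EFinM lee_fin.
    have := r0 x; rewrite -[r x]fineK// lee_fin le_eqVlt => /orP[/eqP <-|rx].
      by rewrite mulr0.
    by rewrite expRN lnK// mulVf// gt_eqF.
  + by move=> x; rewrite mule_ge0// lee_fin expR_ge0.
  + apply: emeasurable_funM => //; apply/measurable_EFinP.
    apply: measurableT_comp => //; exact: measurableT_comp.
Qed.

(* No definedness condition is needed, because [+oo - +oo] is [-oo], which a
   positive factor preserves. *)
Lemma pmuleDr (R : realType) (a : R) (x y : \bar R) : (0 < a)%R ->
  a%:E * (x + y) = a%:E * x + a%:E * y.
Proof.
move=> a0; case: x => [x| |]; case: y => [y| |] //=;
  by rewrite -?EFinD -?EFinM ?(gt0_muley, gt0_muleNy) ?lte_fin//= ?mulrDr//.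
Qed.

(** Positive and negative parts scale separately, and [pmuleDr] recombines them even when both have
    infinite integral. *)
Lemma pintegralZl (d : measure_display) (T : measurableType d)
    (R : realType) (mu : {measure set T -> \bar R}) (a : R) (f : T -> \bar R) :
  (0 < a)%R -> measurable_fun [set: T] f ->
  \int[mu]_x (a%:E * f x) = a%:E * \int[mu]_x f x.
Proof.
move=> a0 mf; rewrite integralE [in RHS]integralE.
rewrite ge0_funeposM ?ge0_funenegM ?ltW//.
rewrite !ge0_integralZl ?lee_fin ?(ltW a0)//; last 2 first.
  exact: measurable_funeneg.
  exact: measurable_funepos.
by rewrite [RHS]pmuleDr// muleN.
Qed.

(** If the right-hand side is [+oo], or [h] has integral [-oo], or the divergence is [+oo], the
    inequality is trivial: its right side is [+oo] or its left side is [expeR -oo = 0]. Outside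
    these cases both [l] and [h] are integrable for [Q], and Jensen's inequality applies. *)
Lemma donsker_varadhan (d : measure_display) (T : measurableType d)
    (R : realType) (Q Q0 : probability T R) (h : T -> \bar R) :
  Q `<< Q0 -> measurable_fun [set: T] h ->
  expeR (\int[Q]_x h x - KL Q Q0) <= \int[Q0]_x expeR (h x).
Proof.
move=> /log_density [l [ml -> cov]] mh.
have meh := measurable_fun_expeR mh.
have [->|RHSy] := eqVneq (\int[Q0]_x expeR (h x)) +oo; first exact: leey.
have [->|hNy] := eqVneq (\int[Q]_x h x) -oo.
  by rewrite addNye integral_ge0// => x _; exact: expeR_ge0.
have [->|KLy] := eqVneq (\int[Q]_x (l x)%:E) +oo.
  by rewrite addeNy integral_ge0// => x _; exact: expeR_ge0.
pose k x := expeR (h x - (l x)%:E).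
have mk : measurable_fun [set: T] k.
  apply: measurable_fun_expeR; apply: emeasurable_funB => //.
  exact/measurable_EFinP.
have k0 x : 0 <= k x by exact: expeR_ge0.
have kint : \int[Q]_x k x <= \int[Q0]_x expeR (h x).
  apply: le_trans (cov _ meh (fun=> expeR_ge0 _)).
  by apply: le_integral_lower => // x; rewrite /k expeRD.
have ky : \int[Q]_x k x < +oo by apply: le_lt_trans kint _; rewrite ltey.
have ik : Q.-integrable [set: T] k.
  by apply/integrableP; split => //; under eq_integral do rewrite gee0_abs//.
have mlE : measurable_fun [set: T] (EFin \o l) by exact/measurable_EFinP.
have il : Q.-integrable [set: T] (EFin \o l).
  (* The negative part of [l] is at most [expR (- l)], whose integral is at most 1 by [cov] at the
     constant 1. *)
  have ln_lty : \int[Q]_x (EFin \o l)^\- x < +oo.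
    apply: (@le_lt_trans _ _ 1); last exact: ltry.
    have := cov (cst 1) (measurable_cst _) (fun=> lee01).
    rewrite [leRHS]integral_cst//= probability_setT mul1e; apply: le_trans.
    apply: le_integral_lower => x //=.
    rewrite mul1e funenegE /= -EFin_max lee_fin ge_max expR_ge0 andbT.
    by apply: le_trans (expR_ge1Dx _); rewrite lerDr.
  apply: integrable_funepos_funeneg => //.
  rewrite ltey; apply: contraNN KLy => /eqP lp; rewrite integralE lp addye//.
  by rewrite eqe_oppLR /= lt_eqF.
have ih : Q.-integrable [set: T] h.
  (* From [y <= expR y] applied to [h - l], the positive part of [h] is at most [|l| + k]. *)
  have hp_lty : \int[Q]_x h^\+ x < +oo.
    apply: (@le_lt_trans _ _ (\int[Q]_x (`|(l x)%:E| + k x))).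
      apply: le_integral_lower => x //; rewrite funeposE ge_max adde_ge0// andbT.
      rewrite /k; case: (h x) => [y| |]; [|by rewrite leey|by rewrite leNye].
      rewrite lee_fin.
      have := expR_ge1Dx (y - l x); have := ler_norm (l x); lra.
    rewrite ge0_integralD//; last exact: measurableT_comp.
    by apply: lte_add_pinfty => //; case/integrableP: il.
  apply: integrable_funepos_funeneg => //.
  rewrite ltey; apply: contraNN hNy => /eqP hn; rewrite integralE hn.
  by rewrite addeNy.
have fh := integrable_fin_num measurableT ih.
have fl := integrable_fin_num measurableT il.
set c := fine (\int[Q]_x h x - \int[Q]_x (l x)%:E).
have cE : \int[Q]_x h x - \int[Q]_x (l x)%:E = c%:E.
  by rewrite fineK// fin_numB fh.
rewrite cE; apply: le_trans kint.
(* Jensen's inequality: [t] is the tangent line of [expR] at the mean [c] of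
   [h - l], evaluated at [h - l]. *)
pose t x := (expR c)%:E * ((h x - (l x)%:E) + (1 - c)%:E).
have ihl : Q.-integrable [set: T] (fun x => h x - (l x)%:E) by exact: integrableB.
have icst : Q.-integrable [set: T] (cst (1 - c)%:E).
  by apply: finite_measure_integrable_cst.
have it : Q.-integrable [set: T] t.
  by apply: integrableZl => //; exact: integrableD.
have -> : expeR c%:E = \int[Q]_x t x.
  rewrite integralZl//; last exact: integrableD.
  rewrite integralD// integralB// cE integral_cst//= probability_setT mule1.
  rewrite -EFinD -EFinM (_ : c + (1 - c) = 1)%R ?mulr1//; ring.
apply: le_integral => // x _; rewrite /t /k.
case: (h x) => [y| |] /=; last 2 first.
- by rewrite leey.
- by rewrite gt0_muleNy ?leNye// lte_fin expR_gt0.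
rewrite -!(EFinD, EFinM) lee_fin.
have -> : expR (y - l x) = (expR c * expR (y - l x - c))%R.
  by rewrite -expRD; congr expR; ring.
rewrite ler_pM2l ?expR_gt0//.
by have := expR_ge1Dx (y - l x - c); lra.
Qed.

(** A zero integral would force [f] to vanish almost everywhere, so the whole space would be null.
    Applied to exponential moments, this keeps their logarithm away from [-oo]. *)
Lemma integral_gt0_probability (d : measure_display) (T : measurableType d)
    (R : realType) (Q : probability T R) (f : T -> \bar R) :
  measurable_fun [set: T] f -> (forall x, 0 < f x) -> 0 < \int[Q]_x f x.
Proof.
move=> mf f0; rewrite lt0e integral_ge0 ?andbT => [|x _]; last exact: ltW.
apply/negP => /eqP If0.
have : \int[Q]_x `|f x| = 0.
  by rewrite -[RHS]If0; apply: eq_integral => x _; rewrite gee0_abs// ltW.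
move/(ae_eq_integral_abs Q measurableT mf) => [N [mN QN fN]].
have NT : N = [set: T].
  rewrite -subTset => x _; apply: fN => /= /(_ I) fx0.
  by have := f0 x; rewrite fx0 ltxx.
move: QN; rewrite NT /= probability_setT => /eqP.
by rewrite onee_eq0.
Qed.

Lemma expeR_scaled_annealedN (d : measure_display) (T : measurableType d)
    (R : realType) (eta : R) (Q : probability T R) (W : T -> R) :
  (0 < eta)%R ->
  expeR (eta%:E * - annealed eta Q W) =
  expeR (- lne (\int[Q]_w (expR (eta * W w))%:E)).
Proof.
by move=> eta0; rewrite muleN muleA -EFinM divff ?gt_eqF// mul1e.
Qed.

Lemma integral_expR_annealedN_le1 (d : measure_display) (T : measurableType d)
    (R : realType) (eta : R) (Q : probability T R) (W : T -> R) :
  (0 < eta)%R -> measurable_fun [set: T] W ->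
  (\int[Q]_w (expR (eta * W w))%:E) * expeR (eta%:E * - annealed eta Q W) <= 1.
Proof.
move=> eta0 mW; rewrite expeR_scaled_annealedN//.
have : 0 < \int[Q]_w (expR (eta * W w))%:E.
  apply: integral_gt0_probability => [|w]; last by rewrite lte_fin expR_gt0.
  apply/measurable_EFinP; apply: measurableT_comp => //.
  exact: measurable_funM.
(* An infinite moment gives [+oo * expeR -oo = +oo * 0 = 0]; a finite one gives exactly 1. *)
case: (\int[Q]_w _) => [m| |] //; last by rewrite /= mule0 lee01.
rewrite lte_fin => m0; rewrite lne_EFin//= -EFinM lee_fin expRN lnK// divff//.
by rewrite gt_eqF.
Qed.

Lemma donsker_varadhan_scaled (d : measure_display) (T : measurableType d)
    (R : realType) (Q Q0 : probability T R) (eta : R) (h : T -> \bar R) :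
  (0 < eta)%R -> Q `<< Q0 -> measurable_fun [set: T] h ->
  expeR (eta%:E * (\int[Q]_x h x - KL Q Q0 * (eta^-1)%:E))
    <= \int[Q0]_x expeR (eta%:E * h x).
Proof.
move=> eta0 QQ0 mh; rewrite pmuleDr// -pintegralZl// muleN.
rewrite [KL _ _ * _]muleC muleA -EFinM divff ?gt_eqF// mul1e.
by apply: donsker_varadhan => //; exact: measurable_funeM.
Qed.

(** Common core of parts 2 and 3. The prior, unlike the posterior, does not depend on [z], so after
    the change of measure Tonelli's theorem lets the expectation over [P] be taken first, for each
    fixed [f]. Values in [\bar R] allow [h] to contain an infinite annealed expectation. *)
Lemma esi_posterior (R : realType) (dZ dF : measure_display)
    (Z : measurableType dZ) (F : measurableType dF) (P : probability Z R)
    (Pi0 : probability F R) (Q : Z -> probability F R) (eta : R)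
    (h : F * Z -> \bar R) :
  (0 < eta)%R -> measurable_fun [set: F * Z] h -> (forall z, Q z `<< Pi0) ->
  (forall f, \int[P]_z expeR (eta%:E * h (f, z)) <= 1) ->
  esi eta P (fun z => \int[Q z]_f h (f, z))
    (fun z => KL (Q z) Pi0 * (eta^-1)%:E).
Proof.
move=> eta0 mh QPi0 h1; rewrite /esi.
have meh : measurable_fun [set: F * Z] (fun w => expeR (eta%:E * h w)).
  by apply: measurable_fun_expeR; exact: measurable_funeM.
apply: (@le_trans _ _ (\int[P]_z \int[Pi0]_f expeR (eta%:E * h (f, z)))).
  apply: le_integral_lower => z; first exact: expeR_ge0.
  apply: donsker_varadhan_scaled => //.
  exact: (measurable_fun_pair1 z mh).
rewrite -(fubini_tonelli (fun w => expeR (eta%:E * h w)) meh); last first.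
  by move=> w; exact: expeR_ge0.
apply: (@le_trans _ _ (\int[Pi0]_f 1)).
  apply: le_integral_lower => f //.
  by apply: integral_ge0 => z _; exact: expeR_ge0.
by rewrite integral_cst//= probability_setT mule1.
Qed.

Theorem proposition25 (R : realType)
    (dZ : measure_display) (Z : measurableType dZ) (P : probability Z R)
    (dF : measure_display) (F : measurableType dF) (Pi0 : probability F R)
    (Pihat : Z -> pprobability F R)
    (g : F -> Z -> R) (eta : R)
    (eta_gt0 : (0 < eta)%R)
    (mg : measurable_fun [set: F * Z] (fun fz => g fz.1 fz.2))
    (mPihat : measurable_fun [set: Z] Pihat)
    (mKL : measurable_fun [set: Z] (fun z => KL (Pihat z) Pi0))
    (equiv : forall z, same_null_sets (Pihat z) Pi0) :
  [/\ esi eta P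
        (fun z => (\int[Pihat z]_f (g f z)%:E)
                  - annealed eta (P \x Pi0)%E (fun zf => g zf.2 zf.1))
        (fun z => KL (Pihat z) Pi0 * (eta^-1)%:E),
      (forall f, esi eta P (fun z => (g f z)%:E) (fun=> 0)) ->
        esi eta P
          (fun z => \int[Pihat z]_f (g f z)%:E)
          (fun z => KL (Pihat z) Pi0 * (eta^-1)%:E)
    & esi eta P
        (fun z => \int[Pihat z]_f ((g f z)%:E - annealed eta P (g f)))
        (fun z => KL (Pihat z) Pi0 * (eta^-1)%:E)].
Proof.
have Pi_dom z : Pihat z `<< Pi0 by case: (equiv z).
have mgE : measurable_fun [set: F * Z] (fun fz => (g fz.1 fz.2)%:E).
  exact/measurable_EFinP.
have mexp : measurable_fun [set: F * Z]
    (fun fz => (expR (eta * g fz.1 fz.2))%:E).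
  apply/measurable_EFinP; apply: measurableT_comp => //.
  exact: measurable_funM.
have mgf f : measurable_fun [set: Z] (g f).
  exact: (measurable_fun_pair2 f mg).
split.
- have mgs : measurable_fun [set: Z * F] (fun zf => g zf.2 zf.1).
    exact: (measurableT_comp mg (@measurable_swap _ _ Z F)).
  have mexps : measurable_fun [set: Z * F]
      (fun zf => (expR (eta * g zf.2 zf.1))%:E).
    exact: (measurableT_comp mexp (@measurable_swap _ _ Z F)).
  (* Here the moment is normalized only on average over the prior, not for each [f], so
     [esi_posterior] does not apply; the constant normalizing factor is instead taken out of the
     integral over [P]. *)
  apply: le_trans (integral_expR_annealedN_le1 (P \x Pi0) eta_gt0 mgs).
  rewrite fubini_tonelli1//= -ge0_integralZr//.
  + apply: le_integral_lower => z; first exact: expeR_ge0.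
    rewrite addeAC pmuleDr// expeRD lee_wpmul2r ?expeR_ge0//.
    apply: donsker_varadhan_scaled => //.
    exact: (measurable_fun_pair1 z mgE).
  + exact: measurable_fun_fubini_tonelli_F.
  + by move=> z _; apply: integral_ge0 => f _; rewrite lee_fin expR_ge0.
  + exact: expeR_ge0.
- move=> g1; apply: (esi_posterior (h := fun w => (g w.1 w.2)%:E)) => // f.
  have := g1 f; rewrite /esi.
  by under eq_integral do rewrite sube0.
- apply: (esi_posterior
    (h := fun w => (g w.1 w.2)%:E - annealed eta P (g w.1))) => //=.
    apply: emeasurable_funB => //.
    (* The exponential moment of [g f] is a partial integral of a jointly measurable function, hence
       measurable in [f]. *)
    apply: (measurableT_comp (f := fun f => annealed eta P (g f))) => //.
    apply: measurable_funeM; apply: measurable_fun_lne.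
    exact: measurable_fun_fubini_tonelli_F mexp _.
  move=> f; apply: le_trans (integral_expR_annealedN_le1 P eta_gt0 (mgf f)).
  rewrite -ge0_integralZr//; last exact: expeR_ge0.
  + by apply: le_integral_lower => z; rewrite ?expeR_ge0// pmuleDr// expeRD.
  + exact: (measurable_fun_pair2 f mexp).
Qed.
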